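(* Let $A$ and $B$ be unital complex Banach algebras such that $A$ is a subalgebra of $B$ and the unit of $B$ lies in $A$. Let $n\ge 1$. If $A$ is inverse closed in $B$ and $A$ is dense in $B$ (in the norm of $B$), then $M_n(A)$ is inverse closed in $M_n(B)$.
   Context: $A$ is a subalgebra of $B$ (with the same unit), but $A$ and $B$ carry their own complete Banach algebra norms $\|\cdot\|_A$, $\|\cdot\|_B$, which need not agree on $A$. For a unital algebra $D$ and unital subalgebra $C\subseteq D$ containing the unit of $D$, $C$ is inverse closed in $D$ if whenever $c\in C$ is invertible in $D$, then $c^{-1}\in C$. $M_n(D)$ denotes the algebra of all $n\times n$ matrices with entries from $D$; for a Banach algebra $D$ it is a Banach algebra under the norm $\|(t_{jk})\|=\sum_{j,k}\|t_{jk}\|_D$ (or any equivalent norm). *)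

(* Defs.v *)
From HB Require Import structures.
From mathcomp Require Import all_boot all_order all_algebra.
From mathcomp Require Export complex.
From mathcomp Require Import boolp classical_sets reals topology normedtype.

Set Implicit Arguments.
Unset Strict Implicit.
Unset Printing Implicit Defensive.

Import Order.TTheory GRing.Theory Num.Theory.
Import numFieldNormedType.Exports.

Local Open Scope ring_scope.

(* Unital Banach algebras over K.  The ring axioms are restated because
   Hierarchy-Builder admits no common refinement of NormedModule and
   GRing.Algebra (numDomainType already combines a norm and a product); the
   canonical algType structure is recovered below.  As in algType, 1 != 0.
   `|1| = 1 is not required, so entrywise sum norms on matrix algebras are
   allowed. *)
HB.mixin Record CompleteNormedModule_isBanachAlgebra (K : numFieldType) T
    of CompleteNormedModule K T := {
  banach_one : T;
  banach_mul : T -> T -> T;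
  banach_mulA : associative banach_mul;
  banach_mul1 : left_id banach_one banach_mul;
  banach_mulr1 : right_id banach_one banach_mul;
  banach_mulDl : left_distributive banach_mul +%R;
  banach_mulDr : right_distributive banach_mul +%R;
  banach_one_neq0 : banach_one != 0;
  banach_scaleAl : forall (k : K) (x y : T),
    k *: banach_mul x y = banach_mul (k *: x) y;
  banach_scaleAr : forall (k : K) (x y : T),
    k *: banach_mul x y = banach_mul x (k *: y);
  banach_normM : forall x y : T, `|banach_mul x y| <= `|x| * `|y|
}.

#[short(type="banachAlgType")]
HB.structure Definition BanachAlgebra (K : numFieldType) :=
  {T of CompleteNormedModule K T & CompleteNormedModule_isBanachAlgebra K T}.

Section BanachAlgebraRing.
Variables (K : numFieldType) (T : banachAlgType K).

#[non_forgetful_inheritance]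
HB.instance Definition _ := GRing.Zmodule_isNzRing.Build T
  (@banach_mulA K T) (@banach_mul1 K T) (@banach_mulr1 K T)
  (@banach_mulDl K T) (@banach_mulDr K T) (@banach_one_neq0 K T).
#[non_forgetful_inheritance]
HB.instance Definition _ :=
  GRing.Lmodule_isLalgebra.Build K T (@banach_scaleAl K T).
#[non_forgetful_inheritance]
HB.instance Definition _ :=
  GRing.Lalgebra_isAlgebra.Build K T (@banach_scaleAr K T).

End BanachAlgebraRing.

(* A subspace S of B, realized as a subtype W of B with projection \val : W -> B,
   where W has a Banach algebra structure of its own.  The linear structure of
   W is that of B, but its norm and topology are unrelated to those of B. *)
HB.structure Definition SubBanachSpace (K : numFieldType)
    (B : lmodType K) (S : pred B) :=
  {W of @GRing.SubLmodule K B S W & BanachAlgebra K W}.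

(* The product and the unit of W are those of B: S is then a subalgebra of B
   containing the unit of B. *)
HB.mixin Record SubBanachSpace_isSubBanachAlgebra (K : numFieldType)
    (B : banachAlgType K) (S : pred B) W of @SubBanachSpace K B S W := {
  subbanach_val1 : \val (banach_one : W) = 1 :> B;
  subbanach_valM : forall x y : W,
    \val (banach_mul x y) = \val x * \val y :> B
}.

#[short(type="subBanachAlgType")]
HB.structure Definition SubBanachAlgebra (K : numFieldType)
    (B : banachAlgType K) (S : pred B) :=
  {W of @SubBanachSpace K B S W & SubBanachSpace_isSubBanachAlgebra K B S W}.

(* The two-sided inverse d of c in D is unique, so this is "c^-1 is in C"
   without a decidable group of units on D. *)
Definition inverse_closed (D : pzRingType) (C : {pred D}) : Prop :=
  forall c d : D, c \in C -> c * d = 1 -> d * c = 1 -> d \in C.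

(* Main.v *)
Require Import Defs.
From HB Require Import structures.
From mathcomp Require Import all_boot all_order all_algebra.
From mathcomp Require Import boolp classical_sets reals topology normedtype.
From mathcomp Require Import sequences.

(** Let [T] have entries in the subalgebra [S] and let [U] be its inverse over
    [B].  By density some [V] over [S] approximates [U] so well that [V *m T]
    is entrywise close to [U *m T = 1].  If [Y] over [S] is a left inverse of
    [V *m T], then [U = (Y *m V *m T) *m U = Y *m V] has entries in [S].  So it
    suffices to invert, over [S], every matrix over [S] that is close enough to
    the identity ([near_identity_left_inverse]).

    This is done by Gaussian elimination.  The top left entry [a] is close to
    1, hence invertible in [B] by completeness of [B] ([banach_inverse]), hence
    invertible in [S] because [S] is inverse closed.  Eliminating with the
    pivot [a] leaves the Schur complement of [a], a smaller matrix over [S].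
    It is again close to the identity: its correction term is a product of two
    small off-diagonal blocks with [a^-1], and [a^-1] is bounded independently
    of the matrix ([banach_inverse_norm]). *)

Set Implicit Arguments.
Unset Strict Implicit.
Unset Printing Implicit Defensive.

Import Order.TTheory GRing.Theory Num.Theory.
Import numFieldNormedType.Exports.

Local Open Scope classical_set_scope.
Local Open Scope ring_scope.

(** The archimedean property of [R] reaches [R[i]] because nonnegative complex
    numbers are real. *)
Lemma complex_expr_lt (R : realType) (q e : R[i]) :
  0 <= q -> q < 1 -> 0 < e -> exists n, q ^+ n < e.
Proof.
move=> q0 q1 e0.
have qE : (complex.Re q)%:C%C = q by rewrite RRe_real// ger0_real.
have eE : (complex.Re e)%:C%C = e by rewrite RRe_real// gtr0_real.
move: q0 q1 e0; rewrite -qE -eE -[0](rmorph0 (real_complex R)).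
rewrite -[1](rmorph1 (real_complex R)) lecR !ltcR /= => q0 q1 e0.
have : `|complex.Re q| < 1 by rewrite ger0_norm.
move=> /cvg_expr/cvgrPdist_lt/(_ _ e0) [N _ /(_ N (leqnn N))] /=.
rewrite sub0r normrN ger0_norm ?exprn_ge0// => qN.
by exists N; rewrite -rmorphXn/= ltcR.
Qed.

(** The iterates [u k] of [f] from [0] are bounded by [C], the sum of the
    geometric series of ratio [q] that starts at [`|f 0|].  Applying [f] [n]
    times to the pair [u m, 0] then gives [`|u (n + m) - u n| <= q ^+ n * C],
    so the iterates are Cauchy, and their limit is fixed. *)
Lemma contraction_fixpoint (R : realType) (X : completeNormedModType R[i])
    (f : X -> X) (q : R[i]) :
    0 <= q -> q < 1 -> (forall x y, `|f x - f y| <= q * `|x - y|) ->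
  exists p, f p = p.
Proof.
move=> q0 q1 fq; pose u k := iter k f 0; pose C := `|f 0| / (1 - q).
have q1' : 0 < 1 - q by rewrite subr_gt0.
have C0 : 0 <= C by rewrite divr_ge0// ltW.
have uC m : `|u m| <= C.
  elim: m => [|m ih]; first by rewrite normr0.
  (* [C] is the bound reproduced by the recursion [x |-> q * x + `|f 0|]. *)
  have f0C : `|f 0| = C - q * C.
    by rewrite -{1}[C]mul1r -mulrBl mulrC divfK// gt_eqF.
  rewrite -[C](subrK (q * C)) -f0C addrC.
  rewrite -[u m.+1](subrK (f 0)) (le_trans (ler_normD _ _))// lerD2r.
  rewrite (le_trans (fq _ _))// subr0; exact: ler_wpM2l.
have u_dist n m : `|u (n + m)%N - u n| <= q ^+ n * C.
  elim: n => [|n ih]; first by rewrite add0n expr0 mul1r subr0.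
  by rewrite addSn (le_trans (fq _ _))// exprS -mulrA ler_wpM2l.
have u_near e : 0 < e -> exists N, forall m, `|u N - u (N + m)%N| < e.
  move=> e0; have C1 : 0 < C + 1 by rewrite ltr_wpDl.
  have [N qN] := complex_expr_lt q0 q1 (divr_gt0 e0 C1).
  exists N => m; rewrite distrC (le_lt_trans (u_dist _ _))//.
  rewrite (@le_lt_trans _ _ (q ^+ N * (C + 1)))//.
    by rewrite ler_wpM2l ?exprn_ge0// lerDl.
  by rewrite -ltr_pdivlMr.
have /cauchy_cvgP/cvg_ex[/= p /cvgrPdist_lt up] : cauchy (u @ \oo).
  apply: cauchy_exP => e e0; have [N uN] := u_near _ e0.
  exists (u N); exists N => //= m /= Nm; rewrite -ball_normE /=.
  by rewrite -(subnKC Nm).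
exists p; apply/eqP; rewrite -subr_eq0 -normr_eq0; apply/negP => /negP.
rewrite -normr_gt0 normr_id => e0.
have [N _ uN] := up _ (divr_gt0 e0 (ltr0Sn _ 1)).
have : `|f p - p| < `|f p - p|.
  rewrite -{1}[f p](subrK (u N.+1)) -addrA (le_lt_trans (ler_normD _ _))//.
  rewrite [ltRHS]splitr ltrD//; last by rewrite distrC uN/=.
  rewrite (le_lt_trans (fq _ _))// (le_lt_trans _ (uN N _))//=.
  by rewrite ler_piMl// ltW.
by rewrite ltxx.
Qed.

Lemma banach_normrM (K : numFieldType) (B : banachAlgType K) (x y : B) :
  `|x * y| <= `|x| * `|y|.
Proof. exact: banach_normM. Qed.

(** With [h = 1 - a], a right inverse of [a] is a fixed point of
    [x |-> 1 + h * x] and a left inverse is a fixed point of [x |-> 1 + x * h];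
    both maps contract by the factor [`|h|]. *)
Lemma banach_inverse (R : realType) (B : banachAlgType R[i]) (a : B) :
  `|1 - a| < 1 -> exists2 b : B, a * b = 1 & b * a = 1.
Proof.
set h := 1 - a => h1.
have [x y|b bE] := @contraction_fixpoint _ B (fun x => 1 + h * x) _ (normr_ge0 h) h1.
  by rewrite /= [1 + h * x]addrC addrKA -mulrBr banach_normrM.
have [x y|c cE] := @contraction_fixpoint _ B (fun x => 1 + x * h) _ (normr_ge0 h) h1.
  by rewrite /= [1 + x * h]addrC addrKA -mulrBl mulrC banach_normrM.
have ab : a * b = 1.
  by rewrite -[a](subKr 1) -/h mulrBl mul1r -{1}bE addrK.
have ca : c * a = 1.
  by rewrite -[a](subKr 1) -/h mulrBr mulr1 -{1}cE addrK.
exists b => //; suff -> : b = c by [].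
by rewrite -[b]mul1r -ca -mulrA ab mulr1.
Qed.

(** The identity [b = 1 + (1 - a) * b] bounds [`|b|] by [`|1| + `|b| / 2].  The
    factor [`|1|] remains because the unit of a Banach algebra may have norm
    greater than one. *)
Lemma banach_inverse_norm (K : numFieldType) (B : banachAlgType K) (a b : B) :
  `|1 - a| <= 2^-1 -> a * b = 1 -> `|b| <= 2 * `|1 : B|.
Proof.
move=> a1 ab; have : `|b| <= `|1 : B| + 2^-1 * `|b|.
  have bE : b = 1 + (1 - a) * b by rewrite mulrBl mul1r ab addrC subrK.
  rewrite {1}bE (le_trans (ler_normD _ _))// lerD2l (le_trans (banach_normrM _ _))//.
  by rewrite ler_wpM2r.
rewrite -lerBlDr -{1}[`|b|]mul1r -mulrBl.
have -> : 1 - 2^-1 = 2^-1 :> K by rewrite [X in X - _](splitr 1) mul1r addrK.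
by rewrite mulrC ler_pdivrMr// mulrC.
Qed.

(** Block elimination with pivot [a].  Read from right to left, the three factors
    clear the column below the pivot, normalize both diagonal blocks to the
    identity, and clear the row to the right of the pivot. *)
Lemma schur_left_inverse (D : pzRingType) (n : nat) (a b : D) (Xur : 'rV[D]_n)
    (Xdl : 'cV[D]_n) (Xdr Y : 'M[D]_n) :
    b * a = 1 -> Y *m (Xdr - Xdl *m (b%:M *m Xur)) = 1%:M ->
  block_mx 1%:M (- (b%:M *m Xur)) 0 1%:M *m block_mx b%:M 0 0 Y
    *m block_mx 1%:M 0 (- (Xdl *m b%:M)) 1%:M
    *m block_mx a%:M Xur Xdl Xdr = 1%:M :> 'M_(1 + n).
Proof.
move=> ba YX; rewrite -!mulmxA (mulmx_block 1%:M) !mul1mx !mul0mx !addr0.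
have dl0 : - (Xdl *m b%:M) *m a%:M + Xdl = 0.
  by rewrite mulNmx -mulmxA -scalar_mxM ba mulmx1 addNr.
have dr : - (Xdl *m b%:M) *m Xur + Xdr = Xdr - Xdl *m (b%:M *m Xur).
  by rewrite addrC mulNmx mulmxA.
rewrite dl0 dr mulmx_block !mul0mx !mulmx0 !addr0 !add0r YX -scalar_mxM ba.
rewrite mulmx_block !mul0mx !mulmx0 !mul1mx !mulmx1 !addr0 !add0r subrr.
by rewrite -scalar_mx_block.
Qed.

Lemma mxOver_block (D : pzRingType) (S : {pred D}) (m1 m2 n1 n2 : nat)
    (Aul : 'M_(m1, n1)) (Aur : 'M_(m1, n2)) (Adl : 'M_(m2, n1))
    (Adr : 'M_(m2, n2)) :
    Aul \is a mxOver S -> Aur \is a mxOver S -> Adl \is a mxOver S ->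
    Adr \is a mxOver S ->
  block_mx Aul Aur Adl Adr \is a mxOver S.
Proof.
move=> /mxOverP ul /mxOverP ur /mxOverP dl /mxOverP dr; apply/mxOverP => i j.
by rewrite mxE; case: splitP => i' _; rewrite mxE; case: splitP => j' _.
Qed.

(** The radius [e] depends only on [n] and on [`|1|], so the induction hypothesis
    applies to every Schur complement.  Keeping [e <= 1 / 2] makes the pivot
    invertible with an inverse of norm at most [2 * `|1|]. *)
Lemma near_identity_left_inverse (R : realType) (B : banachAlgType R[i])
    (S : subringClosed B) (S_inverse_closed : inverse_closed S) (n : nat) :
  exists2 e : R[i], 0 < e <= 2^-1 &
    forall X : 'M[B]_n, X \is a mxOver S ->
      (forall i j, `|X i j - (1%:M : 'M[B]_n) i j| < e) ->
    exists2 Y, Y \is a mxOver S & Y *m X = 1%:M.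
Proof.
elim: n => [|n [e /andP[e0 e1] IH]].
  exists 2^-1 => [|X XS _]; first by rewrite invr_gt0 ltr0Sn lexx.
  by exists X => //; apply/matrixP => -[].
(* For entries within [e'] of the identity, with [e' <= 1], those of the Schur
   complement are within [e' + e' * (2 * `|1|) * e' <= e' * c]. *)
pose c : R[i] := 1 + 2 * `|1 : B|.
have c1 : 1 <= c by rewrite lerDl mulr_ge0.
have c0 : 0 < c by rewrite (lt_le_trans ltr01).
pose e' := e / c.
have e'0 : 0 < e' by rewrite divr_gt0.
have e'e : e' <= e by rewrite ler_pdivrMr// ler_peMr// ltW.
have e'1 : e' <= 2^-1 by rewrite (le_trans e'e).
exists e' => [|X]; first by rewrite e'0.
rewrite -[n.+1]/(1 + n)%N in X *; move=> /mxOverP XS X1.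
have XulS : X (lshift n 0) (lshift n 0) \in S by [].
set a := X (lshift n 0) (lshift n 0) in XulS.
have a1 : `|1 - a| < 2^-1.
  by have := X1 (lshift n 0) (lshift n 0); rewrite mxE eqxx distrC => /lt_le_trans; apply.
have [|b ab ba] := @banach_inverse _ _ a.
  by rewrite (lt_le_trans a1)// invf_le1 ?ler1n// ltr0Sn.
have bS : b \in S by exact: (S_inverse_closed a).
have b2 : `|b| <= 2 * `|1 : B| by apply: banach_inverse_norm ab; exact: ltW.
have XurS : ursubmx X \is a mxOver S by apply/mxOverP => i j; rewrite !mxE.
have XdlS : dlsubmx X \is a mxOver S by apply/mxOverP => i j; rewrite !mxE.
have XdrS : drsubmx X \is a mxOver S by apply/mxOverP => i j; rewrite !mxE.
have bMS : (b%:M : 'M_1) \is a mxOver S by apply: mxOver_scalar; rewrite ?rpred0.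
have oneS m : (1%:M : 'M_m) \is a mxOver S.
  by apply: mxOver_scalar; rewrite ?rpred0 ?rpred1.
have [||Y YS YX] := IH (drsubmx X - dlsubmx X *m (b%:M *m ursubmx X)).
- by rewrite rpredB// !mxOverM.
- move=> i j; rewrite !mxE big_ord1 mul_scalar_mx !mxE addrAC.
  have := X1 (rshift 1 i) (rshift 1 j); rewrite mxE eq_rshift => drij.
  have := X1 (rshift 1 i) (lshift n 0); rewrite mxE eq_rlshift subr0 => dli.
  have := X1 (lshift n 0) (rshift 1 j); rewrite mxE eq_lrshift subr0 => urj.
  rewrite (le_lt_trans (ler_normB _ _))//.
  have -> : e = e' + e' * (2 * `|1 : B|).
    by rewrite -{1}[e']mulr1 -mulrDr divfK// gt_eqF.
  rewrite ltr_leD// (le_trans (banach_normrM _ _))// ler_pM//; first exact: ltW.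
  rewrite (le_trans (banach_normrM _ _))// -[leRHS]mulr1 ler_pM//.
  rewrite ltW// (lt_le_trans urj)// (le_trans e'1)// invf_le1 ?ler1n// ltr0Sn.
have := schur_left_inverse ba YX; rewrite /a.
have <- : ulsubmx X = a%:M by rewrite [LHS]mx11_scalar !mxE.
rewrite submxK; apply: ex_intro2.
by rewrite !mxOverM// mxOver_block// ?rpred0 ?rpredN ?mxOverM// oneS.
Qed.

Lemma dense_mxOver_inverse_closed (R : realType) (B : banachAlgType R[i])
    (S : subringClosed B) (n : nat) (S_inverse_closed : inverse_closed S)
    (S_dense : dense [set x | x \in S]) :
  inverse_closed (mxOver S : {pred 'M[B]_n}).
Proof.
move=> T U TS TU UT.
have [e /andP[e0 _] inv] := near_identity_left_inverse S_inverse_closed n.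
(* [t] exceeds each column sum of the norms of the entries of [T]; approximating
   [U] within [e / t] thus makes [V *m T] closer than [e] to [U *m T]. *)
pose t : R[i] := 1 + \sum_i \sum_j `|T i j|.
have t0 : 0 < t by rewrite ltr_wpDr// sumr_ge0// => i _; rewrite sumr_ge0.
have approx (p : 'I_n * 'I_n) : exists2 v, v \in S & `|U p.1 p.2 - v| < e / t.
  have et : 0 < e / t by rewrite divr_gt0.
  have [|v [Uv vS]] := S_dense _ _ (ball_open (U p.1 p.2) (e / t)).
    by exists (U p.1 p.2); exact: ballxx.
  by exists v => //; move: Uv; rewrite -ball_normE.
have [v vS vU] := fin_all_exists2 approx.
pose V : 'M[B]_n := \matrix_(i, j) v (i, j).
have VS : V \is a mxOver S by apply/mxOverP => i j; rewrite mxE.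
have [||Y YS YVT] := inv (V *m T); first exact: mxOverM.
  move=> i j; rewrite -[1%:M]UT distrC.
  have -> : (U * T) i j - (V *m T) i j = ((U - V) *m T) i j.
    by rewrite mulmxBl [RHS]mxE; congr (_ + _); rewrite [RHS]mxE.
  rewrite mxE (le_lt_trans (ler_norm_sum _ _ _))//.
  have : e / t * \sum_k `|T k j| < e.
    rewrite mulrAC ltr_pdivrMr// ltr_pM2l// (@le_lt_trans _ _ (t - 1))//.
      rewrite /t addrAC subrr add0r ler_sum// => k _.
      by rewrite (bigD1 j)//= lerDl sumr_ge0.
    by rewrite ltrBlDr ltrDl.
  apply: le_lt_trans; rewrite mulr_sumr ler_sum// => k _.
  rewrite (le_trans (banach_normrM _ _))// ler_wpM2r// !mxE ltW//.
  exact: (vU (i, k)).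
suff -> : U = Y *m V by exact: mxOverM.
by rewrite -[U]mul1mx -YVT -!mulmxA [T *m U]TU mulmx1.
Qed.

(** Membership in [S] amounts to being the image under [\val] of an element of
    [A], and [\val] is a ring morphism. *)
Lemma subbanach_subring_closed (K : numFieldType) (B : banachAlgType K)
    (S : pred B) (A : subBanachAlgType S) : subring_closed S.
Proof.
have subval x : x \in S -> exists a : A, \val a = x.
  by move=> Sx; exists (Sub x Sx); rewrite SubK.
split=> [|_ _ /subval[x <-] /subval[y <-]|_ _ /subval[x <-] /subval[y <-]].
- by rewrite -(@subbanach_val1 _ _ _ A); exact: valP.
- by rewrite -raddfB; exact: valP.
- by rewrite -subbanach_valM; exact: valP.
Qed.

Theorem proposition3 (R : realType) (B : banachAlgType R[i]) (S : pred B)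
    (A : subBanachAlgType S) (n : nat) (n_ge1 : (1 <= n)%N)
    (A_inverse_closed : inverse_closed S)
    (A_dense : dense [set x | x \in S]) :
  inverse_closed (mxOver S : {pred 'M[B]_n}).
Proof.
have S_subring := @subbanach_subring_closed _ _ _ A.
pose S' : subringClosed B := HB.pack S (GRing.isSubringClosed.Build B S S_subring).
exact: (@dense_mxOver_inverse_closed _ _ S').
Qed.
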